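(* Let $\rho$ be a kernel permutation. Let $C^1,\dots,C^{f(\rho)}$ be its feasible cells, listed so that $C^i\prec C^j$ whenever $i<j$. Then for any sequence $\alpha_1,\dots,\alpha_{f(\rho)}$ of permutations of arbitrary lengths, there exists $\pi\in S(\rho)$ such that, for each $i$, the subsequence of $\pi$ formed by the entries in the cell $C^i$ of $\pi$ is order-isomorphic to $\alpha_i$.
   Context: Patterns. An occurrence of $132$ in $\pi\in S_n$ is a triple of positions $i<j<k$ with $\pi(i)<\pi(k)<\pi(j)$. The graph $G_\pi$. $G_\pi$ is the bipartite graph whose vertices are the entries of $\pi$ and the occurrences of $132$ in $\pi$. An entry is adjacent to an occurrence exactly when it is one of the three entries of that occurrence. Kernel. Let $\pi(i_1),\dots,\pi(i_s)$, with $i_1<\dots<i_s$, be the entries in the component of $G_\pi$ containing $n$. This subsequence is the kernel of $\pi$. The permutation $\sigma_\pi\in S_s$ order-isomorphic to it is the kernel shape. Kernel permutations. $\rho$ is a kernel permutation if $\rho=\sigma_\pi$ for some $\pi$. $S(\rho)$ is the set of all permutations, of all lengths, with kernel shape $\rho$. Cells. For $\rho\in S_s$ and $\pi\in S(\rho)\cap S_n$, set $i_0=0$, $i_{s+1}=n+1$, and interpret $\pi(i_{\rho^{-1}(0)})$ as $0$. For $1\leq m\leq s$ and $1\leq l\leq s+1$, define $$C_{ml}(\pi)=\{\pi(j): i_{l-1}<j<i_l,\ \pi(i_{\rho^{-1}(m-1)})<\pi(j)<\pi(i_{\rho^{-1}(m)})\}.$$ Feasibility. The cell $C_{ml}$ is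 infeasible if, in $(\rho(1),\dots,\rho(l-1),m-\tfrac12,\rho(l),\dots,\rho(s))$, the inserted entry $m-\tfrac12$ belongs to some occurrence of $132$. Otherwise it is feasible. $f(\rho)$ is the number of feasible cells. Order on cells. For distinct feasible cells, $C_{ml}\prec C_{m'l'}$ if $m\geq m'$ and $l\leq l'$. This is a linear order on the feasible cells. *)

(* Defs.v *)
From mathcomp Require Import all_boot all_order all_fingroup.

Set Implicit Arguments.
Unset Strict Implicit.
Unset Printing Implicit Defensive.

(* A permutation of {1, ..., n} is an element of 'S_n, positions and values
   both being shifted down by one: the value v : 'I_n stands for v + 1.
   Permutations having a kernel are nonempty, hence taken in 'S_n.+1, whose
   largest entry is ord_max. *)

Definition occ132 (n : nat) (w : 'I_n -> nat) (t : 'I_n * 'I_n * 'I_n) : bool :=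
  let: (i, j, k) := t in (i < j < k) && (w i < w k < w j).

Definition occurrence (n : nat) (pi : 'S_n) :=
  {t : 'I_n * 'I_n * 'I_n | occ132 (fun i => pi i) t}.

(* In the vertex type of G_pi, inl v is the entry v (a value, not a position). *)
Definition Gvertex (n : nat) (pi : 'S_n) := ('I_n + occurrence pi)%type.

Definition entry_of (n : nat) (pi : 'S_n) (v : 'I_n) (o : occurrence pi) : bool :=
  let: (i, j, k) := val o in v \in [:: pi i; pi j; pi k].

Definition Gedge (n : nat) (pi : 'S_n) : rel (Gvertex pi) :=
  fun x y => match x, y with
  | inl v, inr o | inr o, inl v => entry_of v o
  | _, _ => false
  end.

Definition kernel (n : nat) (pi : 'S_n.+1) : {set 'I_n.+1} :=
  [set v | connect (@Gedge n.+1 pi) (inl ord_max) (inl v)].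

(* The subsequence of pi formed by the entries belonging to A. *)
Definition subword (n : nat) (pi : 'S_n) (A : {set 'I_n}) : seq nat :=
  [seq val v | v <- codom pi & v \in A].

Definition order_iso (k : nat) (p : 'S_k) (w : seq nat) : Prop :=
  size w = k /\
  forall a b : 'I_k, (p a < p b) = (nth 0 w a < nth 0 w b).

(* kernel_shape pi rho means sigma_pi = rho, i.e. pi belongs to S(rho). *)
Definition kernel_shape (n : nat) (pi : 'S_n.+1) (s : nat) (rho : 'S_s) : Prop :=
  order_iso rho (subword pi (kernel pi)).

Definition kernel_perm (s : nat) (rho : 'S_s) : Prop :=
  exists (n : nat) (pi : 'S_n.+1), kernel_shape pi rho.

(* The 1-based position i_l, with i_0 = 0 and i_(s+1) = (length of pi) + 1. *)
Definition kernel_pos (n : nat) (pi : 'S_n.+1) (l : nat) : nat :=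
  nth n.+2 (0 :: [seq (val i).+1 | i <- enum [set i | pi i \in kernel pi]]) l.

(* The 1-based value pi(i_(rho^-1(m))), which is 0 for m = 0. *)
Definition kernel_val (s : nat) (rho : 'S_s) (n : nat) (pi : 'S_n.+1) (m : nat)
    : nat :=
  nth 0 (0 :: [seq (nth 0 (subword pi (kernel pi)) ((rho^-1)%g a)).+1
              | a <- enum 'I_s]) m.

(* The pair (m, l) is the index of the cell C_(m+1, l+1). *)
Definition cell_index (s : nat) := ('I_s * 'I_s.+1)%type.

Definition cell (s : nat) (rho : 'S_s) (n : nat) (pi : 'S_n.+1)
    (c : cell_index s) : {set 'I_n.+1} :=
  [set pi j | j : 'I_n.+1 &
     (kernel_pos pi c.2 < j.+1 < kernel_pos pi c.2.+1) &&
     (kernel_val rho pi c.1 < (pi j).+1 < kernel_val rho pi c.1.+1)].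

(* The word rho(1), ..., rho(l-1), m - 1/2, rho(l), ..., rho(s) with all its
   letters doubled; for the index c = (m-1, l-1), the inserted letter 2m - 1 is
   at position c.2, and the letter coming from position a of rho is at position
   lift c.2 a. *)
Definition insert_word (s : nat) (rho : 'S_s) (c : cell_index s)
    : 'I_s.+1 -> nat :=
  fun i => if unlift c.2 i is Some a then 2 * (rho a).+1 else (2 * c.1.+1).-1.

Definition infeasible (s : nat) (rho : 'S_s) (c : cell_index s) : bool :=
  [exists t : 'I_s.+1 * 'I_s.+1 * 'I_s.+1,
     occ132 (insert_word rho c) t && (c.2 \in [:: t.1.1; t.1.2; t.2])].

Definition feasible (s : nat) (rho : 'S_s) (c : cell_index s) : bool :=
  ~~ infeasible rho c.

Definition nb_feasible (s : nat) (rho : 'S_s) : nat :=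
  #|[set c : cell_index s | feasible rho c]|.

Definition cell_prec (s : nat) (c c' : cell_index s) : bool :=
  [&& c != c', c'.1 <= c.1 & c.2 <= c'.2].

(* Main.v *)
Require Import Defs.
From mathcomp Require Import all_boot all_order all_fingroup.
From mathcomp Require Import zify.

Set Implicit Arguments.
Unset Strict Implicit.
Unset Printing Implicit Defensive.

(* Place a copy of alpha_i in each feasible cell C^i, the copies being mutually
   decreasing. A kernel permutation has a connected graph. The letters to the
   lower left of a feasible cell form a union of components of that graph, which
   misses the letter bounding the cell from above; so there are none. Hence an
   occurrence of 132 using an inserted letter starts with an inserted letter; its
   other two letters either both lie in the same copy, or both belong to rho, and
   the latter is excluded by feasibility. So occurrences are never mixed, and
   the kernel consists of the letters of rho. *)

(** * Permutations from pairs of strict total orders *)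

Definition strict_total (T : eqType) (r : rel T) : Prop :=
  [/\ irreflexive r, transitive r & forall x y, x != y -> r x y || r y x].

Definition rank (T : finType) (r : rel T) (x : T) : nat := #|[pred y | r y x]|.

Lemma ltn_rank (T : finType) (r : rel T) :
  strict_total r -> forall x y, (rank r x < rank r y) = r x y.
Proof.
move=> st; have [irr tr tot] := st.
have lt_rank x y : r x y -> rank r x < rank r y.
  move=> rxy; apply/proper_card/properP; split.
    by apply/subsetP => z; rewrite !inE => /tr; apply.
  by exists x; rewrite !inE ?irr.
move=> x y; apply/idP/idP; last exact: lt_rank.
have [-> | neq_xy] := eqVneq x y; first by rewrite ltnn.
by case/orP: (tot x y neq_xy) => // /lt_rank /ltnW; rewrite leqNgt => /negPf ->.
Qed.

(** Positions are ranks for [r] and values are ranks for [r']. The permutation can thus be built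
    from an abstract set of letters carrying two orders, with no explicit coordinates; [x0]
    guarantees a nonzero length. *)
Lemma standardization (T : finType) (x0 : T) (r r' : rel T) :
    strict_total r -> strict_total r' ->
  exists (n : nat) (pi : 'S_n.+1) (e : T -> 'I_n.+1),
    [/\ bijective e,
        forall x y, (e x < e y) = r x y &
        forall x y, (pi (e x) < pi (e y)) = r' x y].
Proof.
move=> st st'.
have cardT : #|T| = #|T|.-1.+1 by rewrite prednK //; apply/card_gt0P; exists x0.
set n := #|T|.-1 in cardT.
pose e (q : rel T) x : 'I_n.+1 := inord (rank q x).
have eE q x : strict_total q -> e q x = rank q x :> nat.
  case=> irr _ _; rewrite inordK // -cardT -cardsT.
  apply/proper_card/properP; split; first by apply/subsetP => z; rewrite !inE.
  by exists x; rewrite !inE ?irr.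
have lt_e q x y : strict_total q -> (e q x < e q y) = q x y.
  by move=> stq; rewrite !eE // ltn_rank.
have inj_e q : strict_total q -> injective (e q).
  move=> stq x y exy; apply/eqP/negPn/negP => neq_xy.
  have [_ _ tot] := stq.
  by have := tot x y neq_xy; rewrite -!(lt_e q) // exy ltnn.
have bij_e : bijective (e r).
  by apply: inj_card_bij (inj_e r st) _; rewrite card_ord cardT.
have [e' eK e'K] := bij_e.
have inj_pi : injective (e r' \o e').
  by apply: inj_comp (inj_e r' st') _; exact: can_inj e'K.
exists n, (perm inj_pi), (e r); split=> // [x y | x y].
- exact: lt_e.
- by rewrite !permE /= !eK lt_e.
Qed.

(** The letters [inl a] cut the line into gaps, and [inr b] goes into the gap just before the letter
    of coordinate [g b]. This is why a tie puts [inr b] first. Letters sharing a gap are compared by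
    [r]. *)
Definition merge_lt (A B : Type) (f : A -> nat) (g : B -> nat) (r : rel B) :
    rel (A + B) :=
  fun x y => match x, y with
  | inl a, inl a' => f a < f a'
  | inl a, inr b => f a < g b
  | inr b, inl a => g b <= f a
  | inr b, inr b' => r b b'
  end.

Lemma merge_lt_strict_total (A B : eqType) (f : A -> nat) (g : B -> nat)
    (r : rel B) :
    injective f -> strict_total r -> (forall b b', r b b' -> g b <= g b') ->
  strict_total (merge_lt f g r).
Proof.
move=> inj_f [irr tr tot] mono_g; split.
- by case=> [a | b] /=; rewrite ?ltnn ?irr.
- case=> [y | y] [x | x] [z | z] //=; try lia.
  + move=> le_xy lt_yz.
    have [eq_xz | /tot /orP[] // /mono_g] := eqVneq x z; last lia.
    by move: le_xy; rewrite eq_xz; lia.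
  + by move=> lt_xy /mono_g; lia.
  + by move=> /mono_g; lia.
  + exact: tr.
- case=> [x | x] [y | y] //=; try lia.
  + move=> neq; suff : f x != f y by lia.
    by apply: contraNneq neq => /inj_f ->.
  + exact: tot.
Qed.

Definition lex_lt (T : Type) (h k : T -> nat) : rel T :=
  fun x y => (h x < h y) || ((h x == h y) && (k x < k y)).

Lemma lex_lt_strict_total (T : eqType) (h k : T -> nat) :
    (forall x y, h x = h y -> k x = k y -> x = y) ->
  strict_total (lex_lt h k).
Proof.
move=> inj; rewrite /lex_lt; split=> [x | y x z | x y neq]; try lia.
have [eq_h | ] := eqVneq (h x) (h y); last lia.
have [eq_k | ] := eqVneq (k x) (k y); last lia.
by rewrite (inj x y) ?eqxx in neq.
Qed.

(** * Increasing enumerations and the positions of the kernel *)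

Lemma enum_ord_sorted (n : nat) :
  sorted (fun i j : 'I_n => i < j) (enum 'I_n).
Proof.
by rewrite -(sorted_map (f := val) (e' := ltn)) val_enum_ord iota_ltn_sorted.
Qed.

Lemma nth_map_enum_ord (T : Type) (k : nat) (g : 'I_k -> T) (x0 : T) (a : 'I_k) :
  nth x0 [seq g b | b <- enum 'I_k] a = g a.
Proof. by rewrite (nth_map a) ?size_enum_ord // nth_ord_enum. Qed.

(** Two strictly sorted lists with the same members coincide. This turns a subsequence into a
    parametrization of its positions by [q]. *)
Lemma filter_enum_ord (n k : nat) (P : pred 'I_n) (q : 'I_k -> 'I_n) :
    (forall a b : 'I_k, a < b -> q a < q b) ->
    (forall j, P j <-> exists a, j = q a) ->
  [seq j <- enum 'I_n | P j] = [seq q a | a <- enum 'I_k].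
Proof.
move=> mono_q P_q.
have tr : transitive (fun i j : 'I_n => i < j) by move=> ? ? ?; exact: ltn_trans.
apply: (irr_sorted_eq (leT := fun i j : 'I_n => i < j)) => //.
- by move=> ?; rewrite ltnn.
- exact: sorted_filter (enum_ord_sorted n).
- apply: (homo_sorted (e := fun i j : 'I_k => i < j)) => //.
  exact: enum_ord_sorted.
- move=> j; rewrite mem_filter mem_enum andbT.
  apply/idP/mapP => [/P_q [a ->] | [a _ ->]].
    by exists a; rewrite ?mem_enum.
  by apply/P_q; exists a.
Qed.

Lemma subwordE (n : nat) (pi : 'S_n) (A : {set 'I_n}) :
  subword pi A = [seq val (pi j) | j <- [seq j <- enum 'I_n | pi j \in A]].
Proof. by rewrite /subword codomE filter_map -map_comp. Qed.

Lemma enum_setE (T : finType) (P : pred T) :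
  enum [set x | P x] = [seq x <- enum T | P x].
Proof. by rewrite enumT /enum_mem; apply: eq_filter => x /=; rewrite inE. Qed.

Lemma kernel_embedding (n : nat) (pi : 'S_n.+1) (s : nat) (rho : 'S_s) :
    kernel_shape pi rho ->
  exists q : 'I_s -> 'I_n.+1,
    [/\ forall a b, (q a < q b) = (a < b),
        forall a b, (pi (q a) < pi (q b)) = (rho a < rho b) &
        forall j, pi j \in kernel pi <-> exists a, j = q a].
Proof.
rewrite /kernel_shape subwordE; set ps := filter _ _.
case; rewrite size_map => size_ps iso.
pose q (a : 'I_s) := nth ord0 ps a.
have mono_q (a b : 'I_s) : a < b -> q a < q b.
  apply: (sorted_ltn_nth (leT := fun i j : 'I_n.+1 => i < j));
    rewrite ?inE ?size_ps //.
    by move=> ? ? ?; exact: ltn_trans.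
  by apply: sorted_filter (enum_ord_sorted _) => ? ? ?; exact: ltn_trans.
exists q; split=> [a b | a b | j].
- apply/idP/idP; last exact: mono_q.
  by case: (ltngtP a b) => // [/mono_q | /ord_inj ->]; [lia | rewrite ltnn].
- by rewrite iso !(nth_map ord0) ?size_ps.
have -> : (pi j \in kernel pi) = (j \in ps) by rewrite mem_filter mem_enum andbT.
split=> [j_ps | [a ->]]; last by rewrite mem_nth ?size_ps.
have lt_j : index j ps < s by rewrite -size_ps index_mem.
by exists (Ordinal lt_j); rewrite /q nth_index.
Qed.

(** * Connectedness of kernel permutations *)

(** Such an [A] is a union of components of the graph of [rho], seen on its entries, which are named
    by position. *)
Definition occ_closed (s : nat) (rho : 'S_s) (A : pred 'I_s) : Prop :=
  forall i j k, occ132 (fun a => rho a) (i, j, k) -> A i = A j /\ A j = A k.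

Lemma entry_in_kernel (n : nat) (pi : 'S_n.+1) (o : occurrence pi)
    (v w : 'I_n.+1) :
  entry_of v o -> entry_of w o -> v \in kernel pi -> w \in kernel pi.
Proof.
rewrite !inE => vo wo conn_v; apply: connect_trans conn_v _.
by apply: (@connect_trans _ _ (inr o)); exact: connect1.
Qed.

Lemma kernel_invariant (n : nat) (pi : 'S_n.+1) (A : 'I_n.+1 -> bool) :
    (forall (o : occurrence pi) v w, entry_of v o -> entry_of w o -> A v = A w) ->
  forall v, v \in kernel pi -> A v = A ord_max.
Proof.
move=> A_occ.
(* An occurrence inherits the value of [A] at its first entry; by [A_occ] its other entries give the
   same value. *)
pose AV : pred (Gvertex pi) := fun x => match x with
  | inl v => A v | inr o => let: (i, _, _) := val o in A (pi i) end.
have AVr o : exists2 u, entry_of u o & AV (inr o) = A u.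
  rewrite /AV /entry_of; case: o => [[[i j] k] /= _]; exists (pi i) => //.
  by rewrite inE eqxx.
have AV_closed : closed (@Gedge n.+1 pi) AV.
  case=> [v | o] [w | o'] // vo; rewrite -[LHS]/(AV _) -[RHS]/(AV _).
    by have [u uo' ->] := AVr o'; exact: A_occ vo uo'.
  by have [u uo ->] := AVr o; exact: A_occ uo vo.
by move=> v; rewrite inE => /(closed_connect AV_closed) /esym.
Qed.

(* A kernel entry lies only in occurrences made of kernel entries, so the
   component of the largest entry is also connected as a graph on rho alone. *)
Lemma kernel_perm_connected (s : nat) (rho : 'S_s) (A : pred 'I_s) :
  kernel_perm rho -> occ_closed rho A -> forall a b, A a = A b.
Proof.
case=> n [pi /kernel_embedding [q [lt_q lt_piq ker_q]]] A_closed.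
have inj_q : injective q.
  move=> a b qab; apply/ord_inj.
  by have := lt_q a b; have := lt_q b a; rewrite qab; lia.
pose AG (v : 'I_n.+1) := [exists a, (pi (q a) == v) && A a].
have AGq a : AG (pi (q a)) = A a.
  apply/existsP/idP => [[b /andP[/eqP /perm_inj /inj_q <-]] // | Aa].
  by exists a; rewrite eqxx.
have AGK v : AG v -> v \in kernel pi.
  by case/existsP => a /andP[/eqP <- _]; apply/ker_q; exists a.
have AG_occ (o : occurrence pi) v w : entry_of v o -> entry_of w o ->
    AG v = AG w.
  move=> vo wo.
  (* Outside the kernel [AG] is false at both entries. Inside it, the whole occurrence pulls back
     along [q] to one of [rho]. *)
  have [vK | vK] := boolP (v \in kernel pi); last first.
    have wK : w \notin kernel pi.
      by apply: contra vK; exact: entry_in_kernel wo vo.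
    by rewrite (contraNF (@AGK v)) // (contraNF (@AGK w)).
  have oK u : entry_of u o -> u \in kernel pi.
    by move=> uo; exact: entry_in_kernel vo uo vK.
  case: o vo wo oK => [[[i j] k] /= ijk]; rewrite /entry_of /= => vo wo oK.
  have /ker_q [a ai] : pi i \in kernel pi.
    by apply: oK; rewrite !inE eqxx.
  have /ker_q [b bj] : pi j \in kernel pi.
    by apply: oK; rewrite !inE eqxx orbT.
  have /ker_q [c ck] : pi k \in kernel pi.
    by apply: oK; rewrite !inE eqxx !orbT.
  have [eab ebc] : A a = A b /\ A b = A c.
    by apply: A_closed; move: ijk; rewrite /occ132 ai bj ck !lt_q !lt_piq.
  by move: vo wo; rewrite !inE ai bj ck => /or3P[] /eqP-> /or3P[] /eqP->;
    rewrite !AGq ?eab ?ebc.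
have A_max a : A a = AG ord_max.
  by rewrite -AGq (kernel_invariant AG_occ) //; apply/ker_q; exists a.
by move=> a b; rewrite !A_max.
Qed.

Lemma kernel_perm_nonempty (s : nat) (rho : 'S_s) : kernel_perm rho -> 'I_s.
Proof.
case: s rho => [|s] rho; last by move=> _; exact: ord0.
(* The kernel always contains [ord_max], so its shape cannot have length 0. *)
move=> ker; exfalso; case: ker => n [pi /kernel_embedding [q [_ _ ker_q]]].
suff /ker_q [[]] : pi ((pi^-1)%g ord_max) \in kernel pi by [].
by rewrite permKV inE connect0.
Qed.

(** * Letters of a kernel permutation around a feasible cell *)

Lemma feasible_insert (s : nat) (rho : 'S_s) (c : cell_index s)
    (t : 'I_s.+1 * 'I_s.+1 * 'I_s.+1) :
    feasible rho c -> c.2 \in [:: t.1.1; t.1.2; t.2] ->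
  occ132 (insert_word rho c) t = false.
Proof.
rewrite /feasible /infeasible negb_exists => /forallP /(_ t).
by rewrite negb_and => /orP[/negPf // | /negPf ->].
Qed.

Lemma insert_word_lift (s : nat) (rho : 'S_s) (c : cell_index s) (a : 'I_s) :
  insert_word rho c (lift c.2 a) = 2 * (rho a).+1.
Proof. by rewrite /insert_word liftK. Qed.

Lemma insert_word_at (s : nat) (rho : 'S_s) (c : cell_index s) :
  insert_word rho c c.2 = (2 * c.1.+1).-1.
Proof. by rewrite /insert_word unlift_none. Qed.

(** Here and in the next two lemmas, the name tells whether the inserted letter plays the 1, the 3
    or the 2 of the pattern 132. *)
Lemma feasible_one (s : nat) (rho : 'S_s) (c : cell_index s) (a b : 'I_s) :
  feasible rho c -> c.2 <= a < b -> c.1 <= rho b < rho a -> False.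
Proof.
move=> fc ab rab; have := @feasible_insert _ _ _ (c.2, lift c.2 a, lift c.2 b) fc.
rewrite /occ132 /= !insert_word_lift insert_word_at !inE eqxx /bump.
by move=> /(_ isT); lia.
Qed.

Lemma feasible_three (s : nat) (rho : 'S_s) (c : cell_index s) (a b : 'I_s) :
  feasible rho c -> a < c.2 <= b -> rho a < rho b < c.1 -> False.
Proof.
move=> fc ab rab; have := @feasible_insert _ _ _ (lift c.2 a, c.2, lift c.2 b) fc.
rewrite /occ132 /= !insert_word_lift insert_word_at !inE eqxx orbT /bump.
by move=> /(_ isT); lia.
Qed.

Lemma feasible_two (s : nat) (rho : 'S_s) (c : cell_index s) (a b : 'I_s) :
  feasible rho c -> a < b < c.2 -> rho a < c.1 <= rho b -> False.
Proof.
move=> fc ab rab; have := @feasible_insert _ _ _ (lift c.2 a, lift c.2 b, c.2) fc.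
rewrite /occ132 /= !insert_word_lift insert_word_at !inE eqxx !orbT /bump.
by move=> /(_ isT); lia.
Qed.

Lemma feasible_no_lower_left (s : nat) (rho : 'S_s) (c : cell_index s)
    (a : 'I_s) :
  kernel_perm rho -> feasible rho c -> a < c.2 -> c.1 <= rho a.
Proof.
move=> ker fc lt_a; rewrite leqNgt; apply/negP => lt_rho.
pose SW (x : 'I_s) := (x < c.2) && (rho x < c.1).
suff SW_closed : occ_closed rho SW.
  (* The letter of value [c.1] is the upper boundary of the cell, so it is not in [SW]. *)
  have := kernel_perm_connected ker SW_closed a ((rho^-1)%g c.1).
  by rewrite /SW lt_a lt_rho permKV ltnn andbF.
(* The entry at [i] is to the lower left of the other two, so it is in [SW] as soon as one of them
   is. Conversely let it be in [SW]. If [j] is left of the cell, the roles 2 and 3 put [j], then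
   [k], in [SW]; otherwise role 3 forces the entry at [k] above the cell, against role 1. *)
move=> i j k; rewrite /occ132 /SW => /andP[ijk rikj].
have := @feasible_one _ rho c j k fc.
have := @feasible_three _ rho c i k fc.
have := @feasible_two _ rho c i j fc.
by lia.
Qed.

(** * The inflation and its kernel *)

(* An inflation of rho: inl a is the letter of rho at position a, and
   inr (i; u) is the letter at position u of the copy of alpha_i in cell C^i. *)
Definition inflation (s f : nat) (len : 'I_f -> nat) : Type :=
  ('I_s + {i : 'I_f & 'I_(len i)})%type.

Definition pos_lt (s f : nat) (len : 'I_f -> nat) (C : 'I_f -> cell_index s) :
    rel (inflation s len) :=
  merge_lt (fun a : 'I_s => a : nat) (fun p => (C (tag p)).2)
    (lex_lt (fun p : {i : 'I_f & 'I_(len i)} => tag p : nat)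
      (fun p => tagged p : nat)).

(** Positions increase with the index of the copy; [rev_ord] makes values decrease with it, in
    agreement with the order on cells. *)
Definition val_lt (s f : nat) (rho : 'S_s) (len : 'I_f -> nat)
    (C : 'I_f -> cell_index s) (alpha : forall i, 'S_(len i)) :
    rel (inflation s len) :=
  merge_lt (fun a : 'I_s => rho a : nat) (fun p => (C (tag p)).1)
    (lex_lt (fun p : {i : 'I_f & 'I_(len i)} => rev_ord (tag p) : nat)
      (fun p => alpha (tag p) (tagged p) : nat)).

Definition of_kernel (s f : nat) (len : 'I_f -> nat) (x : inflation s len) :=
  if x is inl _ then true else false.

Lemma cell_prec_mono (s f : nat) (C : 'I_f -> cell_index s) (i j : 'I_f) :
    (forall i j : 'I_f, i < j -> cell_prec (C i) (C j)) -> i <= j ->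
  (C j).1 <= (C i).1 /\ (C i).2 <= (C j).2.
Proof.
move=> C_sorted; rewrite leq_eqVlt => /predU1P[/ord_inj -> // | /C_sorted].
by case/and3P.
Qed.

Lemma pos_lt_strict_total (s f : nat) (len : 'I_f -> nat)
    (C : 'I_f -> cell_index s) :
    (forall i j : 'I_f, i < j -> cell_prec (C i) (C j)) ->
  strict_total (pos_lt (len := len) C).
Proof.
move=> C_sorted; apply: merge_lt_strict_total; first exact: val_inj.
  apply: lex_lt_strict_total => -[i u] [j v] /= /val_inj eq_ij.
  by subst j => /val_inj ->.
move=> p q; rewrite /lex_lt /= => lt_pq.
have le_pq : tag p <= tag q by case/orP: lt_pq => [/ltnW | /andP[/eqP-> _]].
by have [] := cell_prec_mono C_sorted le_pq.
Qed.

Lemma val_lt_strict_total (s f : nat) (rho : 'S_s) (len : 'I_f -> nat)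
    (C : 'I_f -> cell_index s) (alpha : forall i, 'S_(len i)) :
    (forall i j : 'I_f, i < j -> cell_prec (C i) (C j)) ->
  strict_total (val_lt rho C alpha).
Proof.
move=> C_sorted; apply: merge_lt_strict_total.
- by move=> a b /val_inj /perm_inj.
- apply: lex_lt_strict_total => -[i u] [j v] /ord_inj /rev_ord_inj /= eq_ij.
  by subst j => /val_inj /perm_inj ->.
move=> [i u] [j v]; rewrite /lex_lt /= => lt_ij.
have le_ji : j <= i by have := ltn_ord i; have := ltn_ord j; lia.
by have [] := cell_prec_mono C_sorted le_ji.
Qed.

Lemma no_mixed_occurrence (s f : nat) (rho : 'S_s) (len : 'I_f -> nat)
    (C : 'I_f -> cell_index s) (alpha : forall i, 'S_(len i))
    (x y z : inflation s len) :
    kernel_perm rho -> (forall i, feasible rho (C i)) ->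
    (forall i j : 'I_f, i < j -> cell_prec (C i) (C j)) ->
    pos_lt C x y -> pos_lt C y z ->
    val_lt rho C alpha x z -> val_lt rho C alpha z y ->
  of_kernel x = of_kernel y /\ of_kernel y = of_kernel z.
Proof.
move=> ker fC C_sorted.
have [_ pos_tr _] := pos_lt_strict_total len C_sorted.
have [_ val_tr _] := val_lt_strict_total rho alpha C_sorted.
have SW i (a : 'I_s) : a < (C i).2 -> (C i).1 <= rho a.
  exact: feasible_no_lower_left ker (fC i).
(* Distinct copies are mutually decreasing, so two inserted letters forming an ascent share a
   copy. *)
have tag_eq p q : pos_lt C (inr p) (inr q : inflation s len) ->
    val_lt rho C alpha (inr p) (inr q) -> tag p = tag q.
  rewrite /pos_lt /val_lt /= /lex_lt /= => pq pq'; apply: ord_inj.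
  by have := ltn_ord (tag p); have := ltn_ord (tag q); lia.
case: x => [a | p].
(* A letter of [rho] playing the 1 would be to the lower left of the cell of an inserted letter,
   against [SW]. *)
- case: y => [b | q]; case: z => [c | r] //= xy yz xz zy.
  + by have := SW _ _ (ltn_trans xy yz); rewrite leqNgt xz.
  + by have := SW _ _ xy; have := ltn_trans xz zy; lia.
  + have := val_tr (inr r) (inl a) (inr q) xz zy.
    by rewrite /= ltnNge (SW _ _ xy).
(* If exactly one of [y] and [z] is inserted, it is in the copy of [x], and the remaining letter of
   [rho] would separate two letters of one copy, by position or by value. *)
- case: y => [b | q]; case: z => [c | r] //= xy yz xz zy.
  + by case: (@feasible_one _ rho (C (tag p)) b c (fC _)); rewrite ?xy ?xz.
  + have eq_pr := tag_eq p r (pos_tr (inl b) (inr p) (inr r) xy yz) xz.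
    by move: yz; rewrite -eq_pr ltnNge xy.
  + have eq_pq := tag_eq p q xy (val_tr (inl c) (inr p) (inr q) xz zy).
    by move: zy; rewrite -eq_pq ltnNge xz.
Qed.

Lemma kernel_inflation (s f : nat) (rho : 'S_s) (len : 'I_f -> nat)
    (C : 'I_f -> cell_index s) (alpha : forall i, 'S_(len i))
    (n : nat) (pi : 'S_n.+1) (e : inflation s len -> 'I_n.+1) :
    kernel_perm rho -> (forall i, feasible rho (C i)) ->
    (forall i j : 'I_f, i < j -> cell_prec (C i) (C j)) -> bijective e ->
    (forall x y, (e x < e y) = pos_lt C x y) ->
    (forall x y, (pi (e x) < pi (e y)) = val_lt rho C alpha x y) ->
  forall x, (pi (e x) \in kernel pi) = of_kernel x.
Proof.
move=> ker fC C_sorted [e' eK e'K] lt_e lt_pi.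
pose K v := of_kernel (e' ((pi^-1)%g v)).
have KE j : K (pi j) = of_kernel (e' j) by rewrite /K permK.
have K_occ (o : occurrence pi) v w : entry_of v o -> entry_of w o -> K v = K w.
  case: o => [[[i j] k] /= ijk]; rewrite /entry_of /= => vo wo.
  have [eij ejk] : K (pi i) = K (pi j) /\ K (pi j) = K (pi k).
    rewrite !KE; case/andP: ijk => /andP[ij jk] /andP[ik kj].
    by apply: (no_mixed_occurrence ker fC C_sorted (alpha := alpha));
      rewrite -?lt_e -?lt_pi !e'K.
  by move: vo wo; rewrite !inE => /or3P[] /eqP-> /or3P[] /eqP->;
    rewrite ?eij ?ejk.
(* The largest entry is not inserted: each inserted letter is below the letter of [rho] bounding its
   cell from above. *)
have [a0 max_a0] : exists a, ord_max = pi (e (inl a)).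
  case def_x: (e' ((pi^-1)%g ord_max)) => [a | p].
    by exists a; rewrite -def_x e'K permKV.
  have : pi (e (inr p)) < pi (e (inl ((rho^-1)%g (C (tag p)).1))).
    by rewrite lt_pi /= permKV.
  by rewrite -def_x e'K permKV ltnNge -ltnS ltn_ord.
have K_max : K ord_max by rewrite max_a0 KE eK.
move=> x; apply/idP/idP => [/(kernel_invariant K_occ) | ].
  by rewrite KE eK K_max => ->.
case: x => [a _ | //].
(* For the converse inclusion, occurrences in [rho] remain occurrences in [pi], so connectedness of
   [rho] links every letter of [rho] to the largest entry. *)
pose A b := pi (e (inl b)) \in kernel pi.
suff A_closed : occ_closed rho A.
  rewrite -/(A a) (kernel_perm_connected ker A_closed a a0) /A -max_a0.
  by rewrite inE connect0.
move=> i j k ijk.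
have pijk : occ132 (fun j => pi j) (e (inl i), e (inl j), e (inl k)).
  by rewrite /occ132 !lt_e !lt_pi.
pose o : occurrence pi := Sub (e (inl i), e (inl j), e (inl k)) pijk.
have oi : entry_of (pi (e (inl i))) o by rewrite /entry_of /= !inE eqxx.
have oj : entry_of (pi (e (inl j))) o by rewrite /entry_of /= !inE eqxx orbT.
have ok : entry_of (pi (e (inl k))) o by rewrite /entry_of /= !inE eqxx !orbT.
by split; apply/idP/idP; apply: entry_in_kernel; eassumption.
Qed.

(** * Kernel coordinates and the contents of the cells *)

Lemma kernel_inflation_positions (s f : nat) (len : 'I_f -> nat)
    (n : nat) (pi : 'S_n.+1) (e : inflation s len -> 'I_n.+1) :
    bijective e -> (forall x, (pi (e x) \in kernel pi) = of_kernel x) ->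
  forall j, pi j \in kernel pi <-> exists a, j = e (inl a).
Proof.
move=> [e' eK e'K] ker_e j.
rewrite -(e'K j) ker_e; case: (e' j) => [a | p] /=; split=> //; first by exists a.
by case=> a /(can_inj eK).
Qed.

Lemma kernel_positions (n : nat) (pi : 'S_n.+1) (s : nat)
    (q : 'I_s -> 'I_n.+1) :
    (forall a b, (q a < q b) = (a < b)) ->
    (forall j, pi j \in kernel pi <-> exists a, j = q a) ->
  [seq j <- enum 'I_n.+1 | pi j \in kernel pi] = [seq q a | a <- enum 'I_s].
Proof. by move=> lt_q; apply: filter_enum_ord => a b; rewrite lt_q. Qed.

Lemma kernel_posS (n : nat) (pi : 'S_n.+1) (s : nat)
    (q : 'I_s -> 'I_n.+1) (a : 'I_s) :
    (forall a b, (q a < q b) = (a < b)) ->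
    (forall j, pi j \in kernel pi <-> exists a, j = q a) ->
  kernel_pos pi a.+1 = (q a).+1.
Proof.
move=> lt_q ker_q; rewrite /kernel_pos enum_setE (kernel_positions lt_q ker_q).
by rewrite -map_comp /= nth_map_enum_ord.
Qed.

Lemma kernel_pos_last (n : nat) (pi : 'S_n.+1) (s : nat)
    (q : 'I_s -> 'I_n.+1) :
    (forall a b, (q a < q b) = (a < b)) ->
    (forall j, pi j \in kernel pi <-> exists a, j = q a) ->
  kernel_pos pi s.+1 = n.+2.
Proof.
move=> lt_q ker_q; rewrite /kernel_pos enum_setE (kernel_positions lt_q ker_q).
(* Index [s.+1] is past the end of the list, so the default [n.+2] is read: the length of [pi] plus
   one. *)
by rewrite nth_default //= 2!size_map size_enum_ord.
Qed.

Lemma nth_subword_kernel (n : nat) (pi : 'S_n.+1) (s : nat)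
    (q : 'I_s -> 'I_n.+1) (a : 'I_s) :
    (forall a b, (q a < q b) = (a < b)) ->
    (forall j, pi j \in kernel pi <-> exists a, j = q a) ->
  nth 0 (subword pi (kernel pi)) a = pi (q a).
Proof.
move=> lt_q ker_q; rewrite subwordE (kernel_positions lt_q ker_q) -map_comp.
by rewrite nth_map_enum_ord.
Qed.

Lemma kernel_valS (n : nat) (pi : 'S_n.+1) (s : nat) (rho : 'S_s)
    (q : 'I_s -> 'I_n.+1) (m : 'I_s) :
    (forall a b, (q a < q b) = (a < b)) ->
    (forall j, pi j \in kernel pi <-> exists a, j = q a) ->
  kernel_val rho pi m.+1 = (pi (q ((rho^-1)%g m))).+1.
Proof.
move=> lt_q ker_q; rewrite /kernel_val /=.
by rewrite nth_map_enum_ord (nth_subword_kernel _ lt_q).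
Qed.

Lemma mem_cell_inflation (s f : nat) (rho : 'S_s) (len : 'I_f -> nat)
    (C : 'I_f -> cell_index s) (alpha : forall i, 'S_(len i))
    (n : nat) (pi : 'S_n.+1) (e : inflation s len -> 'I_n.+1) :
    bijective e ->
    (forall x y, (e x < e y) = pos_lt C x y) ->
    (forall x y, (pi (e x) < pi (e y)) = val_lt rho C alpha x y) ->
    (forall x, (pi (e x) \in kernel pi) = of_kernel x) ->
  forall c x, (pi (e x) \in cell rho pi c) =
    if x is inr p then C (tag p) == c else false.
Proof.
move=> bij_e lt_e lt_pi ker_e c x.
pose q (a : 'I_s) := e (inl a).
have lt_q a b : (q a < q b) = (a < b) by exact: lt_e.
have ker_q := kernel_inflation_positions bij_e ker_e.
have posS := kernel_posS _ lt_q ker_q.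
have valS := kernel_valS rho _ lt_q ker_q.
have pos_last := kernel_pos_last lt_q ker_q.
have pos_lo l : l <= s -> (kernel_pos pi l < (e x).+1) =
    match x with inl a => l <= a | inr p => l <= (C (tag p)).2 end.
  case: l => [_ | l lt_l]; first by case: (x).
  by rewrite (posS (Ordinal lt_l)) ltnS lt_e; case: (x).
have pos_hi l : l <= s -> ((e x).+1 < kernel_pos pi l.+1) =
    match x with inl a => a < l | inr p => (C (tag p)).2 <= l end.
  (* For [l = s] no letter of [rho] bounds the cell on the right, and the bound is the default
     value. *)
  rewrite leq_eqVlt => /predU1P[-> | lt_l].
    rewrite pos_last ltnS ltn_ord; case: (x) => [a | p]; first by rewrite ltn_ord.
    by rewrite -ltnS ltn_ord.
  by rewrite (posS (Ordinal lt_l)) ltnS lt_e; case: (x).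
have val_lo l : l < s -> (kernel_val rho pi l < (pi (e x)).+1) =
    match x with inl a => l <= rho a | inr p => l <= (C (tag p)).1 end.
  case: l => [_ | l /ltnW lt_l]; first by case: (x).
  by rewrite (valS (Ordinal lt_l)) ltnS lt_pi; case: (x) => [a | p] /=;
    rewrite ?permKV.
have val_hi l : l < s -> ((pi (e x)).+1 < kernel_val rho pi l.+1) =
    match x with inl a => rho a < l | inr p => (C (tag p)).1 <= l end.
  move=> lt_l.
  by rewrite (valS (Ordinal lt_l)) ltnS lt_pi; case: (x) => [a | p] /=;
    rewrite ?permKV.
have -> : (pi (e x) \in cell rho pi c) =
    (kernel_pos pi c.2 < (e x).+1 < kernel_pos pi c.2.+1) &&
    (kernel_val rho pi c.1 < (pi (e x)).+1 < kernel_val rho pi c.1.+1).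
  apply/imsetP/idP => [[j] | in_c]; last by exists (e x); rewrite ?inE.
  by rewrite inE => in_c /perm_inj ->.
have le_c : c.2 <= s by rewrite -ltnS.
rewrite pos_lo ?pos_hi ?val_lo ?val_hi //.
(* A letter of [rho] would need a position both at least and less than [c.2]. For an inserted
   letter, the two pairs of opposite inequalities force its cell to be [c]. *)
case: x {pos_lo pos_hi val_lo val_hi} => [a | p]; first by lia.
by rewrite -!eqn_leq andbC [_ == c]/eq_op /= (eq_sym (nat_of_ord c.1))
  (eq_sym (nat_of_ord c.2)).
Qed.

Theorem theorem3 (s : nat) (rho : 'S_s) (rho_kernel : kernel_perm rho)
    (C : 'I_(nb_feasible rho) -> cell_index s)
    (C_feasible : forall c : cell_index s, feasible rho c <-> exists i, C i = c)
    (C_sorted : forall i j : 'I_(nb_feasible rho), i < j -> cell_prec (C i) (C j))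
    (len : 'I_(nb_feasible rho) -> nat)
    (alpha : forall i : 'I_(nb_feasible rho), 'S_(len i)) :
  exists (n : nat) (pi : 'S_n.+1),
    kernel_shape pi rho /\
    forall i : 'I_(nb_feasible rho),
      order_iso (alpha i) (subword pi (cell rho pi (C i))).
Proof.
have fC i : feasible rho (C i) by apply/C_feasible; exists i.
have inj_C : injective C.
  move=> i j eq_C; apply: ord_inj.
  by case: (ltngtP i j) => // /C_sorted; rewrite /cell_prec eq_C eqxx.
have x0 : inflation s len := inl (kernel_perm_nonempty rho_kernel).
have [n [pi [e [bij_e lt_e lt_pi]]]] :=
  standardization x0 (pos_lt_strict_total len C_sorted)
    (val_lt_strict_total rho alpha C_sorted).
have ker_e := kernel_inflation rho_kernel fC C_sorted bij_e lt_e lt_pi.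
have [e' eK e'K] := bij_e.
exists n, pi; split.
  have lt_q (a b : 'I_s) : (e (inl a) < e (inl b)) = (a < b) by exact: lt_e.
  have ker_q := kernel_inflation_positions bij_e ker_e.
  split=> [|a b]; last by rewrite !(nth_subword_kernel _ lt_q ker_q) lt_pi.
  by rewrite subwordE (kernel_positions lt_q ker_q) 2!size_map size_enum_ord.
(* The map [q] lists the positions of the copy of [alpha i]. Within one copy both lexicographic
   orders reduce to their second coordinate. *)
move=> i; pose q (u : 'I_(len i)) := e (inr (Tagged (fun i => 'I_(len i)) u)).
rewrite /order_iso subwordE (@filter_enum_ord _ _ _ q).
- rewrite 2!size_map size_enum_ord; split=> // a b; rewrite -map_comp.
  by rewrite !nth_map_enum_ord /= /q lt_pi /= /lex_lt /= ltnn eqxx.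
- by move=> a b; rewrite /q lt_e /= /lex_lt /= ltnn eqxx.
move=> j; rewrite -(e'K j) (mem_cell_inflation bij_e lt_e lt_pi ker_e).
case: (e' j) => [a | [i' u]] /=; split=> //.
- by case=> u /(can_inj eK).
(* Injectivity of [C] keeps the other copies out of this cell. *)
- by move=> /eqP /inj_C eq_i; subst i'; exists u.
- by case=> v /(can_inj eK) [eq_i _]; rewrite eq_i.
Qed.
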